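(* For all integers $n\geq 1$ and $p\geq 0$, \[ \sum_{k=0}^{n}\frac{k^{p}(-1)^{k}}{\binom{n}{k}}=\frac{n+1}{n+2}\left[(-1)^{n+p}B_{p,n+1}(-n)+B_{p,n+1}\right]. \]
   Context: For each integer $q\geq 0$, the $q$-Bernoulli numbers $B_{j,q}$ ($j\ge 0$) are defined by $B_{0,q}=1$ and $B_{j+1,q}=qB_{j,q}-\frac{(q+1)^{2}}{q+2}B_{j,q+1}$ ($j,q\ge 0$), and the $q$-Bernoulli polynomials by $B_{j,q}(x)=\sum_{i=0}^{j}\binom{j}{i}x^{j-i}B_{i,q}$. Thus $B_{p,n+1}$ and $B_{p,n+1}(x)$ denote the $p$-th $(n+1)$-Bernoulli number and polynomial (first index = degree, second index = parameter). The convention $0^0=1$ is used. *)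

(* Defs.v *)
From mathcomp Require Import all_boot all_order all_algebra.

Set Implicit Arguments.
Unset Strict Implicit.
Unset Printing Implicit Defensive.

Import GRing.Theory.
Local Open Scope ring_scope.

(* The q-Bernoulli number B_{j,q}: the first argument is the degree index j,
   the second one the parameter q. *)
Fixpoint qbernoulli (j q : nat) : rat :=
  if j is i.+1 then
    q%:R * qbernoulli i q - (q.+1)%:R ^+ 2 / (q.+2)%:R * qbernoulli i q.+1
  else 1.

Definition qbernoulli_poly (j q : nat) : {poly rat} :=
  \sum_(i < j.+1) ('C(j, i)%:R * qbernoulli i q) *: 'X^(j - i).

(* Main.v *)
Require Import Defs.
From HB Require Import structures.
From mathcomp Require Import all_boot all_order all_algebra.
From mathcomp Require Import ring.

Import GRing.Theory Num.Theory.
Local Open Scope ring_scope.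

(** Umbral argument: let [L n] be the functional sending ['X^i] to
    [(n+1)/(n+2) * B_{i,n+1}].  It behaves like the divergent sum
    [f |-> \sum_(k >= 0) f k * (-1)^k / 'C(n, k)]: it satisfies the relations that
    the contiguity of [1 / 'C(n, k)] in [n] and Abel summation suggest, namely
    [L n (u f) = (n+1) (L n f - L (n+1) f)] (the defining recurrence) and
    [(n+2) L n f = (n+1) (L (n+1) (f(u) - f(u-1)) + f(-1))].
    Inductively on [f], the finite sum over [0 <= k <= n] of [f] is then the sum
    of the two end contributions [L n f] and [(-1)^n L n (f(n - u))]. *)

Definition umbral (n : nat) (f : {poly rat}) : rat :=
  n.+1%:R / n.+2%:R * \sum_(i < size f) f`_i * qbernoulli i n.+1.

Lemma umbral_wide n (f : {poly rat}) N : (size f <= N)%N ->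
  umbral n f = n.+1%:R / n.+2%:R * \sum_(i < N) f`_i * qbernoulli i n.+1.
Proof.
move=> leN; congr (_ * _).
rewrite -!(big_mkord xpredT (fun i => f`_i * qbernoulli i n.+1)).
rewrite [RHS](big_cat_nat _ leN) //=.
rewrite [X in _ = _ + X]big_nat_cond [X in _ = _ + X]big1 ?addr0 // => i.
by case/andP=> /andP[lei _] _; rewrite nth_default ?mul0r.
Qed.

Lemma umbral_linear n : linear_for *%R (umbral n).
Proof.
move=> a f g; pose N := maxn (size (a *: f + g)) (maxn (size f) (size g)).
rewrite !(@umbral_wide _ _ N) ?leq_maxl ?leq_max ?leqnn ?orbT //.
rewrite mulrCA -mulrDr; congr (_ * _); rewrite mulr_sumr -big_split.
by apply: eq_bigr => i _; rewrite /= coefD coefZ mulrDl mulrA.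
Qed.

HB.instance Definition _ n :=
  GRing.isLinear.Build rat {poly rat} rat _ (umbral n) (umbral_linear n).

Lemma umbral0 n : umbral n 0 = 0.
Proof. exact: (raddf0 (umbral n)). Qed.

Lemma umbralD n : {morph umbral n : f g / f + g}.
Proof. exact: (raddfD (umbral n)). Qed.

Lemma umbralB n : {morph umbral n : f g / f - g}.
Proof. exact: (raddfB (umbral n)). Qed.

Lemma umbralZ n a f : umbral n (a *: f) = a * umbral n f.
Proof. exact: (scalarZ (umbral n)). Qed.

Lemma umbralXn n i :
  umbral n 'X^i = n.+1%:R / n.+2%:R * qbernoulli i n.+1.
Proof.
rewrite /umbral size_polyXn big_ord_recr big1 => [|j _] /=.
  by rewrite coefXn eqxx mul1r add0r.
by rewrite coefXn ltn_eqF ?ltn_ord // mul0r.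
Qed.

Lemma umbralC n c : umbral n c%:P = c * (n.+1%:R / n.+2%:R).
Proof.
by rewrite -[c%:P]mulr1 mul_polyC umbralZ -(expr0 'X) umbralXn /= mulr1.
Qed.

(** The prefactor [(n+1)/(n+2)] of [umbral] absorbs the factor [(q+1)^2/(q+2)] of the recurrence at
    [q = n+1], coefficient by coefficient. *)
Lemma umbralMX n (f : {poly rat}) :
  umbral n (f * 'X) = n.+1%:R * (umbral n f - umbral n.+1 f).
Proof.
rewrite (@umbral_wide _ _ (size f).+1); last first.
  by rewrite (leq_trans (size_polyMleq _ _)) // size_polyX addn2.
rewrite big_ord_recl coefMX /= mul0r add0r /umbral mulrBr !mulr_sumr -sumrB.
apply: eq_bigr => i _; rewrite coefMX /= expr2.
by field; rewrite -!natrD !pnatr_eq0.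
Qed.

(** By induction on [f] for all [n] at once: multiplication by ['X] raises the parameter, so the
    hypothesis is needed at both [n] and [n.+1]. *)
Lemma umbral_diff n (f : {poly rat}) :
  n.+2%:R * umbral n f =
  n.+1%:R * (umbral n.+1 (f - (f \Po ('X - 1))) + f.[-1]).
Proof.
have nz k : k.+1%:R != 0 :> rat by rewrite pnatr_eq0.
elim/poly_ind: f n => [|f c IH] n.
  by rewrite comp_poly0 subr0 !umbral0 horner0 addr0 !mulr0.
rewrite comp_polyD comp_polyM comp_polyX comp_polyC hornerMXaddC.
set g := f \Po _ in IH *.
have -> : f * 'X + c%:P - (g * ('X - 1) + c%:P) = (f - g) * 'X + g by ring.
rewrite !umbralD !umbralMX umbralC.
have E0 := IH n; have E1 := IH n.+1.
rewrite !umbralB in E0 E1 *.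
move: E0 E1; set a := umbral n f; set b := umbral n.+1 f.
set d := umbral n.+1 g; set e := umbral n.+2 f; set h := umbral n.+2 g.
set z := f.[-1]; move=> E0 E1.
(* The two hypotheses are solved for the shifted terms [d] and [h]; what remains is a rational
   identity. *)
have -> : d = b + z - n.+2%:R / n.+1%:R * a.
  apply: (mulfI (nz n)); transitivity (n.+1%:R * (b + z) - n.+2%:R * a).
    by rewrite E0; ring.
  by field; rewrite nat1r.
have -> : h = e + z - n.+3%:R / n.+2%:R * b.
  apply: (mulfI (nz n.+1)); transitivity (n.+2%:R * (e + z) - n.+3%:R * b).
    by rewrite E1; ring.
  by field; rewrite -natrD pnatr_eq0.
by field; rewrite -?natrD ?nat1r !pnatr_eq0.
Qed.

Definition bin_sum (n : nat) (f : {poly rat}) : rat :=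
  \sum_(0 <= k < n.+1) f.[k%:R] * ((-1) ^+ k / 'C(n, k)%:R).

(** Divide [(n+1-k) C(n+1,k) = (n+1) C(n,k)] by both binomials. *)
Lemma invbin_row n k : (k <= n)%N ->
  k%:R / 'C(n, k)%:R = n.+1%:R * ('C(n, k)%:R^-1 - 'C(n.+1, k)%:R^-1) :> rat.
Proof.
move=> lekn; have := mul_bin_down n.+1 k; rewrite /=.
move=> /(congr1 (fun m => m%:R : rat)).
rewrite !natrM natrB ?leqW // => E.
have b0 : 'C(n, k)%:R != 0 :> rat by rewrite pnatr_eq0 -lt0n bin_gt0.
have b1 : 'C(n.+1, k)%:R != 0 :> rat by rewrite pnatr_eq0 -lt0n bin_gt0 leqW.
apply: (mulIf b0); apply: (mulIf b1); rewrite divfK //.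
have -> : n.+1%:R * ('C(n, k)%:R^-1 - 'C(n.+1, k)%:R^-1) * 'C(n, k)%:R * 'C(n.+1, k)%:R
  = n.+1%:R * 'C(n.+1, k)%:R - n.+1%:R * 'C(n, k)%:R :> rat by field; rewrite b0 b1.
by rewrite E; ring.
Qed.

(** Over the common denominator [(n+1) C(n,k)], the reciprocals on the right have numerators [n+1-k]
    and [k+1], with sum [n+2]. *)
Lemma invbin_pascal n k : (k <= n)%N ->
  'C(n, k)%:R^-1 =
  n.+1%:R / n.+2%:R * ('C(n.+1, k)%:R^-1 + 'C(n.+1, k.+1)%:R^-1) :> rat.
Proof.
move=> lekn; have := mul_bin_down n.+1 k; have := mul_bin_diag n.+1 k.
move=> /(congr1 (fun m => m%:R : rat)) E1 /(congr1 (fun m => m%:R : rat)) E2.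
rewrite /= !natrM ?natrB ?leqW // in E1 E2.
have b0 : 'C(n, k)%:R != 0 :> rat by rewrite pnatr_eq0 -lt0n bin_gt0.
have b1 : 'C(n.+1, k)%:R != 0 :> rat by rewrite pnatr_eq0 -lt0n bin_gt0 leqW.
have b2 : 'C(n.+1, k.+1)%:R != 0 :> rat by rewrite pnatr_eq0 -lt0n bin_gt0.
have n1 : n.+1%:R != 0 :> rat by rewrite pnatr_eq0.
have -> : 'C(n.+1, k)%:R^-1 = (n.+1%:R - k%:R) / (n.+1%:R * 'C(n, k)%:R) :> rat.
  by apply: (mulIf b1); rewrite mulVf // mulrAC -E2 divff // mulf_neq0.
have -> : 'C(n.+1, k.+1)%:R^-1 = k.+1%:R / (n.+1%:R * 'C(n, k)%:R) :> rat.
  by apply: (mulIf b2); rewrite mulVf // mulrAC -E1 divff // mulf_neq0.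
by field; rewrite b0 -!natrD ?nat1r !pnatr_eq0.
Qed.

Lemma bin_sumC n c :
  bin_sum n c%:P = c * (n.+1%:R / n.+2%:R * (1 + (-1) ^+ n)).
Proof.
(* The alternating sign turns the sum of neighbouring reciprocals into a difference, so the sum
   telescopes to [a n.+1 - a 0 = (-1)^n + 1]. *)
pose a k : rat := - ((-1) ^+ k / 'C(n.+1, k)%:R).
transitivity (c * (n.+1%:R / n.+2%:R * \sum_(0 <= k < n.+1) (a k.+1 - a k))).
  rewrite !mulr_sumr; apply: eq_big_nat => k /= lekn.
  by rewrite hornerC invbin_pascal // /a exprS; ring.
by rewrite telescope_sumr // /a bin0 binn exprS expr0 !divr1; ring.
Qed.

(** Counterpart of [umbralMX]; the boundary term removes the entry [k = n+1], which row [n+1] has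
    and row [n] lacks. *)
Lemma bin_sumMX n (f : {poly rat}) :
  bin_sum n (f * 'X) =
  n.+1%:R * (bin_sum n f - bin_sum n.+1 f - (-1) ^+ n * f.[n.+1%:R]).
Proof.
rewrite [bin_sum n.+1 f]/bin_sum big_nat_recr //= binn opprD.
have -> : \sum_(0 <= k < n.+1) f.[k%:R] * ((-1) ^+ k / 'C(n.+1, k)%:R) =
  bin_sum n f - bin_sum n (f * 'X) / n.+1%:R.
  rewrite /bin_sum mulr_suml -sumrB; apply: eq_big_nat => k /= lekn.
  have n1 : n.+1%:R != 0 :> rat by rewrite pnatr_eq0.
  rewrite hornerMX; apply: (mulIf n1); rewrite mulrBl divfK //.
  have -> : f.[k%:R] * k%:R * ((-1) ^+ k / 'C(n, k)%:R) =
    f.[k%:R] * (-1) ^+ k * (k%:R / 'C(n, k)%:R) by ring.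
  by rewrite invbin_row //; ring.
have n1 : n.+1%:R != 0 :> rat by rewrite pnatr_eq0.
by rewrite exprS; field; rewrite nat1r.
Qed.

Lemma bin_sumD n (f g : {poly rat}) : bin_sum n (f + g) = bin_sum n f + bin_sum n g.
Proof.
by rewrite -big_split; apply: eq_bigr => k _; rewrite /= hornerD mulrDl.
Qed.

Lemma bin_sum_umbral n (f : {poly rat}) :
  bin_sum n f = umbral n f + (-1) ^+ n * umbral n (f \Po (n%:R%:P - 'X)).
Proof.
elim/poly_ind: f n => [|f c IH] n.
  rewrite comp_poly0 !umbral0 mulr0 addr0 /bin_sum big1 // => k _.
  by rewrite horner0 mul0r.
rewrite comp_polyD comp_polyM comp_polyX comp_polyC bin_sumD bin_sumMX bin_sumC.
rewrite !IH !umbralD umbralMX !umbralC.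
have shift : (f \Po (n%:R%:P - 'X)) \Po ('X - 1) = f \Po (n.+1%:R%:P - 'X).
  rewrite -comp_polyA; congr (_ \Po _); rewrite comp_polyB comp_polyC comp_polyX.
  by rewrite -natr1 polyCD; ring.
(* The reflected polynomial takes the value [f(n+1)] at [-1], which is the boundary term of
   [bin_sumMX]; by [shift], its translate is the reflection for [n+1]. *)
have := umbral_diff n (f \Po (n%:R%:P - 'X)).
rewrite shift horner_comp hornerD hornerN hornerC hornerX opprK natr1.
set h := f \Po (n%:R%:P - 'X); set h' := f \Po (n.+1%:R%:P - 'X).
have -> : h * (n%:R%:P - 'X) = n%:R *: h - h * 'X.
  by rewrite -mul_polyC; ring.
rewrite !umbralB umbralZ umbralMX exprS => /eqP.
(* The two sides of the goal differ by exactly [(-1)^n] times this relation. *)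
rewrite -subr_eq0 => /eqP E; rewrite -[RHS]addr0 -(mulr0 ((-1) ^+ n)) -E.
by ring.
Qed.

Theorem theorem5 (n p : nat) (hn : (1 <= n)%N) :
  \sum_(0 <= k < n.+1) (k%:R ^+ p * (-1) ^+ k / 'C(n, k)%:R : rat) =
  (n.+1)%:R / (n.+2)%:R *
    ((-1) ^+ (n + p) * (qbernoulli_poly p n.+1).[- n%:R] + qbernoulli p n.+1).
Proof.
transitivity (bin_sum n 'X^p).
  by apply: eq_bigr => k _; rewrite hornerXn mulrA.
(* The near end gives [qbernoulli p n.+1]; the far end, [(n - u)^p] expanded binomially, is matched
   termwise with [(-1)^p] times the polynomial at [-n]. *)
rewrite bin_sum_umbral umbralXn comp_Xn_poly exprBn (raddf_sum (umbral n)) /=.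
rewrite mulrDr [RHS]addrC; congr (_ + _).
rewrite /qbernoulli_poly horner_sum exprD -[_ ^+ n * _ * _]mulrA [RHS]mulrCA; congr (_ * _).
rewrite !mulr_sumr; apply: eq_bigr => i _.
have lei : (i <= p)%N by rewrite -ltnS.
have -> : (-1) ^+ i * n%:R%:P ^+ (p - i) * 'X^i *+ 'C(p, i) =
  ((-1) ^+ i * n%:R ^+ (p - i) * 'C(p, i)%:R) *: 'X^i :> {poly rat}.
  by rewrite -mul_polyC !polyCM !polyC_exp polyCN polyC1 polyC_natr; ring.
have sgn : (-1) ^+ p * (- n%:R) ^+ (p - i) = (-1) ^+ i * n%:R ^+ (p - i) :> rat.
  by rewrite -{1}(subnK lei) exprD mulrAC -exprMn mulrNN mul1r mulrC.
by rewrite umbralZ umbralXn hornerZ hornerXn -sgn; ring.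
Qed.
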